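(* Let $\mathcal{X}\subset\mathbb{R}^D\setminus\{0\}$ be a finite set of $N$ points. Suppose that every linear subspace $L\subset\mathbb{R}^D$ with $1\le\dim(L)\le D-1$ satisfies $\frac{|\mathcal{X}\cap L|}{N}<\frac{\dim(L)}{D}$. Let $\boldsymbol\Sigma^{(0)}\in\mathrm{S}_{++}(D)$, and define $\boldsymbol\Sigma^{(k+1)}=T(\boldsymbol\Sigma^{(k)})$ for $k\ge0$. Then the sequence $\boldsymbol\Sigma^{(k)}$ converges to the unique minimizer of $F$ over $\{\boldsymbol\Sigma\in\mathrm{S}_{++}(D):\operatorname{tr}(\boldsymbol\Sigma)=1\}$.
   Context: $\mathrm{S}_{++}(D)$ is the set of real symmetric positive definite $D\times D$ matrices. For $\boldsymbol\Sigma\in\mathrm{S}_{++}(D)$, the function $F$ is defined by $$F(\boldsymbol\Sigma)=\frac{1}{N}\sum_{\boldsymbol{x}\in\mathcal{X}}\log(\boldsymbol{x}^T\boldsymbol\Sigma^{-1}\boldsymbol{x})+\frac{1}{D}\log\det(\boldsymbol\Sigma).$$ The operator $T$ is defined by $$T(\boldsymbol\Sigma)=\frac{\sum_{\boldsymbol{x}\in\mathcal{X}}\frac{\boldsymbol{x}\boldsymbol{x}^T}{\boldsymbol{x}^T\boldsymbol\Sigma^{-1}\boldsymbol{x}}}{\operatorname{tr}\Big(\sum_{\boldsymbol{x}\in\mathcal{X}}\frac{\boldsymbol{x}\boldsymbol{x}^T}{\boldsymbol{x}^T\boldsymbol\Sigma^{-1}\boldsymbol{x}}\Big)}.$$ $|\cdot|$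 denotes cardinality, and $\mathcal{X}\cap L$ is the set of points of $\mathcal{X}$ lying in $L$. *)

(* Defs.v *)
From HB Require Import structures.
From Stdlib Require Import Reals Lra ClassicalEpsilon FunctionalExtensionality
  PropExtensionality.
From mathcomp Require Import all_boot all_order all_algebra.

Set Implicit Arguments.
Unset Strict Implicit.
Unset Printing Implicit Defensive.

Definition R_eqb (x y : R) : bool := if Req_EM_T x y then true else false.
Lemma R_eqP : Equality.axiom R_eqb.
Proof. move=> x y; rewrite /R_eqb; case: Req_EM_T => h; [exact: ReflectT | exact: ReflectF]. Qed.

HB.instance Definition _ := hasDecEq.Build R R_eqP.

Definition R_find (P : pred R) (_ : nat) : option R :=
  match excluded_middle_informative (exists x, P x) with
  | left h => Some (proj1_sig (constructive_indefinite_description _ h))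
  | right _ => None
  end.

Lemma R_find_correct P n x : R_find P n = Some x -> P x.
Proof.
rewrite /R_find; case: excluded_middle_informative => // h [<-].
exact: proj2_sig (constructive_indefinite_description _ h).
Qed.

Lemma R_find_complete (P : pred R) : (exists x, P x) -> exists n, R_find P n.
Proof. by move=> h; exists 0%N; rewrite /R_find; case: excluded_middle_informative. Qed.

Lemma R_find_ext (P Q : pred R) : P =1 Q -> R_find P =1 R_find Q.
Proof.
move=> h n; have -> : P = Q by apply: functional_extensionality.
by [].
Qed.

HB.instance Definition _ := hasChoice.Build R R_find_correct R_find_complete R_find_ext.

Lemma R_addA : forall x y z : R, Rplus x (Rplus y z) = Rplus (Rplus x y) z. Proof. move=> *; lra. Qed.
Lemma R_addC : forall x y : R, Rplus x y = Rplus y x. Proof. move=> *; lra. Qed.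
Lemma R_add0 : forall x : R, Rplus R0 x = x. Proof. move=> *; lra. Qed.
Lemma R_addN : forall x : R, Rplus (Ropp x) x = R0. Proof. move=> *; lra. Qed.

HB.instance Definition _ := GRing.isZmodule.Build R R_addA R_addC R_add0 R_addN.

Lemma R_mulA : forall x y z : R, Rmult x (Rmult y z) = Rmult (Rmult x y) z. Proof. move=> *; ring. Qed.
Lemma R_mulC : forall x y : R, Rmult x y = Rmult y x. Proof. move=> *; ring. Qed.
Lemma R_mul1 : forall x : R, Rmult R1 x = x. Proof. move=> *; ring. Qed.
Lemma R_mulDl : forall x y z : R, Rmult (Rplus x y) z = Rplus (Rmult x z) (Rmult y z). Proof. move=> *; ring. Qed.
Lemma R_one_neq0 : (R1 : R) != R0.
Proof. by apply/eqP; exact: R1_neq_R0. Qed.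

HB.instance Definition _ :=
  GRing.Zmodule_isComNzRing.Build R R_mulA R_mulC R_mul1 R_mulDl R_one_neq0.

Lemma R_mulVf (x : R) : x != R0 -> Rmult (Rinv x) x = R1.
Proof. by move=> /eqP h; apply: Rinv_l. Qed.
Lemma R_inv0 : Rinv R0 = R0. Proof. exact: Rinv_0. Qed.

HB.instance Definition _ := GRing.ComNzRing_isField.Build R R_mulVf R_inv0.

Local Open Scope ring_scope.

Definition posdef (D : nat) (S : 'M[R]_D) : Prop :=
  S^T = S /\ forall x : 'rV[R]_D, x != 0 -> Rlt R0 ((x *m S *m x^T) 0 0).

Definition qinv (D : nat) (S : 'M[R]_D) (x : 'rV[R]_D) : R :=
  (x *m invmx S *m x^T) 0 0.

Definition Fobj (D : nat) (X : seq 'rV[R]_D) (S : 'M[R]_D) : R :=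
  Rplus (Rdiv (\sum_(x <- X) ln (qinv S x)) (INR (size X)))
        (Rdiv (ln (\det S)) (INR D)).

Definition Tmap (D : nat) (X : seq 'rV[R]_D) (S : 'M[R]_D) : 'M[R]_D :=
  let M := \sum_(x <- X) (Rinv (qinv S x)) *: (x^T *m x) in
  (Rinv (\tr M)) *: M.

Definition is_trace1_minimizer (D : nat) (X : seq 'rV[R]_D) (S : 'M[R]_D) : Prop :=
  posdef S /\ \tr S = 1%R /\
  forall S' : 'M[R]_D, posdef S' -> \tr S' = 1%R -> Rle (Fobj X S) (Fobj X S').

Definition mx_cv (m n : nat) (u : nat -> 'M[R]_(m, n)) (l : 'M[R]_(m, n)) : Prop :=
  forall i j, Un_cv (fun k => u k i j) (l i j).

(* Main.v *)
Require Import Defs.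
From HB Require Import structures.
From Stdlib Require Import Reals ClassicalEpsilon Classical.
From mathcomp Require Import all_boot all_order all_algebra perm zify ring lra.

(* Write q(x) = x^T S^-1 x, with S the current matrix.

   Descent.  For positive definite G and M, ln det (G M) <= tr (G M) - D, with
   equality only if M = G^-1.  Applied to G = S^-1 and M = (D/N) sum x x^T / q(x),
   for which tr (G M) = D, and combined with ln t <= t - 1, this gives
   F (T S) <= F S, with equality only if T S = S.

   Uniqueness.  Let S1, S2 be fixed points of T of trace 1 and let r be the
   maximum of q1/q2 over the data.  Then S2 <= r S1, so that
   P = S2^-1 - S1^-1 / r is positive semidefinite, and P is singular because the
   maximum is attained.  The fixed point equation forces every data point into
   ker P or into its S1^-1-orthogonal complement; the subspace condition, applied
   to both, leaves only P = 0.

   Coercivity.  Pick a basis b_0, ..., b_(D-1) among the data greedily, each time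
   minimizing q outside the span of the previous choices.  Points with small q lie
   in the flag spanned by the b_j, so the subspace condition and an Abel summation
   give D sum ln q(x) >= N sum ln q(b_j) + (ln q(b_(D-1)) - ln q(b_0)).  Together
   with Hadamard's inequality for the Gram matrix of the b_j, a bound on F bounds
   the condition number of S, hence det S from below when tr S = 1.

   So the iterates stay in a compact subset of the positive definite matrices, and
   by descent all their cluster points are fixed points, that is, the same point.
   It minimizes F, because the iteration can be started at any competitor. *)

Set Implicit Arguments.
Unset Strict Implicit.
Unset Printing Implicit Defensive.
Import Order.TTheory GRing.Theory Num.Theory.
Local Open Scope ring_scope.

(** * The ordered field of real numbers *)

(** Boolean comparisons are what the ordered field structure on [R] asks for; with it the generic
    inequalities and [lra] apply. *)
Definition Rleb (x y : R) : bool := if Rle_dec x y then true else false.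
Definition Rltb (x y : R) : bool := if Rlt_dec x y then true else false.

Lemma RlebP (x y : R) : reflect (Rle x y) (Rleb x y).
Proof. by rewrite /Rleb; case: Rle_dec => h; constructor. Qed.

Lemma RltbP (x y : R) : reflect (Rlt x y) (Rltb x y).
Proof. by rewrite /Rltb; case: Rlt_dec => h; constructor. Qed.

Lemma Rleb0D (x y : R) : Rleb 0 x -> Rleb 0 y -> Rleb 0 (x + y).
Proof. by move=> /RlebP hx /RlebP hy; apply/RlebP; apply: Rplus_le_le_0_compat. Qed.

Lemma Rleb0M (x y : R) : Rleb 0 x -> Rleb 0 y -> Rleb 0 (x * y).
Proof. by move=> /RlebP hx /RlebP hy; apply/RlebP; apply: Rmult_le_pos. Qed.

Lemma Rleb0_anti (x : R) : Rleb 0 x -> Rleb x 0 -> x = 0.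
Proof. by move=> /RlebP hx /RlebP hy; apply: Rle_antisym. Qed.

Lemma Rleb_sub (x y : R) : Rleb 0 (y - x) = Rleb x y.
Proof.
apply/RlebP/RlebP => h; first exact/Rge_le/Rminus_ge/Rle_ge.
exact/Rge_le/Rge_minus/Rle_ge.
Qed.

Lemma Rleb0_total (x : R) : Rleb 0 x || Rleb x 0.
Proof. by case: (Rle_lt_dec 0 x) => [/RlebP -> //|/Rlt_le/RlebP ->]; rewrite orbT. Qed.

Lemma Rleb0_norm (x : R) : Rleb 0 x -> Rabs x = x.
Proof. by move/RlebP/Rle_ge; exact: Rabs_right. Qed.

Lemma Rltb_def (x y : R) : Rltb x y = (y != x) && Rleb x y.
Proof.
apply/RltbP/andP => [h | [/eqP ne /RlebP]].
  split; last exact/RlebP/Rlt_le.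
  by apply/eqP => e; move: h; rewrite e; exact: Rlt_irrefl.
by case=> // e; case: ne.
Qed.

HB.instance Definition _ := Num.IntegralDomain_isLeReal.Build R
  Rleb0D Rleb0M Rleb0_anti Rleb_sub Rleb0_total Rabs_Ropp Rleb0_norm Rltb_def.

Lemma RleP (x y : R) : reflect (Rle x y) (x <= y).
Proof. exact: RlebP. Qed.

Lemma RltP (x y : R) : reflect (Rlt x y) (x < y).
Proof. exact: RltbP. Qed.

Lemma INR_natr n : INR n = n%:R :> R.
Proof. by elim: n => // n IHn; rewrite S_INR IHn -natr1. Qed.

Lemma lnM (x y : R) : 0 < x -> 0 < y -> ln (x * y) = ln x + ln y.
Proof. by move=> /RltP hx /RltP hy; exact: ln_mult. Qed.

Lemma lnV (x : R) : 0 < x -> ln x^-1 = - ln x.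
Proof. by move=> /RltP hx; exact: ln_Rinv. Qed.

Lemma lnF (x y : R) : 0 < x -> 0 < y -> ln (x / y) = ln x - ln y.
Proof. by move=> hx hy; rewrite lnM ?invr_gt0 // lnV. Qed.

Lemma ln_le_sub1 (x : R) : 0 < x -> ln x <= x - 1.
Proof.
move=> /RltP hx; have /RleP := exp_ineq1_le (ln x).
by rewrite exp_ln // => h; rewrite lerBrDr addrC.
Qed.

Lemma ln_eq_sub1 (x : R) : 0 < x -> ln x = x - 1 -> x = 1.
Proof.
move=> /RltP hx e; have [l0|/eqP l0] := eqVneq (ln x) 0.
  by move: e; rewrite l0 => /eqP; rewrite eq_sym subr_eq0 => /eqP.
have /RltP := exp_ineq1 (ln x) l0.
by rewrite exp_ln // e -[Rplus _ _]/(1 + (x - 1)) [1 + _]addrC subrK ltxx.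
Qed.

Lemma ln_prod (I : Type) (r : seq I) (f : I -> R) :
  (forall i, 0 < f i) -> ln (\prod_(i <- r) f i) = \sum_(i <- r) ln (f i).
Proof.
move=> f0; elim: r => [|i r IH]; first by rewrite !big_nil; exact: ln_1.
by rewrite !big_cons lnM ?IH // prodr_gt0.
Qed.

Lemma ln_expn (x : R) k : 0 < x -> ln (x ^+ k) = k%:R * ln x.
Proof.
by move=> x0; rewrite -[k in LHS]card_ord -prodr_const ln_prod // sumr_const card_ord mulr_natl.
Qed.

Lemma ln_le_inv (x y : R) : 0 < x -> 0 < y -> ln x <= ln y -> x <= y.
Proof.
move=> /RltP x0 /RltP y0; rewrite !leNgt; apply: contra => /RltP h.
exact/RltP/ln_increasing.
Qed.

Lemma sumr_const_size (T : Type) (s : seq T) (c : R) :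
  \sum_(x <- s) c = c *+ size s.
Proof. by rewrite big_const_seq count_predT iter_addr addr0. Qed.

Lemma exists_argmax (T : eqType) (f : T -> R) (s : seq T) : (0 < size s)%N ->
  exists2 x, x \in s & forall y, y \in s -> f y <= f x.
Proof.
elim: s => // x [|z s] IH _.
  by exists x => [|y]; rewrite inE // => /eqP ->.
have [y ys hy] := IH isT; have [xy | /ltW yx] := leP (f x) (f y).
  by exists y => [|u]; rewrite in_cons ?ys ?orbT // => /predU1P[->|/hy].
exists x => [|u]; rewrite in_cons ?eqxx // => /predU1P[-> //|/hy uy].
exact: le_trans yx.
Qed.

(** * Positive definite matrices *)

Definition qform n (S : 'M[R]_n) (x : 'rV[R]_n) : R := (x *m S *m x^T) 0 0.

Lemma mx11_eq (A B : 'M[R]_1) : A 0 0 = B 0 0 -> A = B.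
Proof. by move=> e; rewrite [A]mx11_scalar [B]mx11_scalar e. Qed.

Lemma qformD n (S T : 'M[R]_n) x : qform (S + T) x = qform S x + qform T x.
Proof. by rewrite /qform mulmxDr mulmxDl mxE. Qed.

Lemma qformB n (S T : 'M[R]_n) x : qform (S - T) x = qform S x - qform T x.
Proof. by rewrite /qform mulmxBr mulmxBl !mxE. Qed.

Lemma qformZ n a (S : 'M[R]_n) x : qform (a *: S) x = a * qform S x.
Proof. by rewrite /qform -scalemxAr -scalemxAl mxE. Qed.

Lemma qform_sum n (I : Type) (r : seq I) (S : I -> 'M[R]_n) x :
  qform (\sum_(i <- r) S i) x = \sum_(i <- r) qform (S i) x.
Proof.
elim: r => [|i r IH]; last by rewrite !big_cons qformD IH.
by rewrite !big_nil /qform mulmx0 mul0mx mxE.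
Qed.

Lemma qform_congr n (S A : 'M[R]_n) x : qform (A *m S *m A^T) x = qform S (x *m A).
Proof. by rewrite /qform trmx_mul !mulmxA. Qed.

Lemma qform_rank1 n (u x : 'rV[R]_n) :
  qform (u^T *m u) x = (x *m u^T) 0 0 ^+ 2.
Proof.
rewrite /qform mulmxA -mulmxA mxE big_ord1 expr2.
have -> : u *m x^T = (x *m u^T)^T by rewrite trmx_mul trmxK.
by rewrite [_^T _ _]mxE.
Qed.

Lemma qform_delta n (S : 'M[R]_n) i : qform S (delta_mx 0 i) = S i i.
Proof. by rewrite /qform trmx_delta -rowE -colE !mxE. Qed.

Lemma qform_tr n (S : 'M[R]_n) x : qform S x = \tr (S *m (x^T *m x)).
Proof. by rewrite /qform mulmxA mxtrace_mulC mulmxA /mxtrace big_ord1. Qed.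

Lemma posdef_gt0 n (S : 'M[R]_n) x : posdef S -> x != 0 -> 0 < qform S x.
Proof. by case=> _ h /h /RltP. Qed.

Lemma posdef_ge0 n (S : 'M[R]_n) x : posdef S -> 0 <= qform S x.
Proof.
move=> hS; have [->|/(posdef_gt0 hS)/ltW//] := eqVneq x 0.
by rewrite /qform !mul0mx mxE.
Qed.

Lemma posdefI n (S : 'M[R]_n) :
  S^T = S -> (forall x, x != 0 -> 0 < qform S x) -> posdef S.
Proof. by move=> hs h; split=> // x /h /RltP. Qed.

Lemma posdef_unit n (S : 'M[R]_n) : posdef S -> S \in unitmx.
Proof.
move=> hS; rewrite -row_free_unit -kermx_eq0; apply/rowV0P => v /sub_kermxP vS.
apply/eqP; apply: contraT => /(posdef_gt0 hS).
by rewrite /qform vS mul0mx mxE ltxx.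
Qed.

Lemma posdef_congr n (S A : 'M[R]_n) :
  posdef S -> A \in unitmx -> posdef (A *m S *m A^T).
Proof.
move=> hS uA; apply: posdefI => [|x x0].
  by rewrite !trmx_mul trmxK hS.1 mulmxA.
rewrite qform_congr; apply: (posdef_gt0 hS).
apply: contra x0 => /eqP e; apply/eqP.
by rewrite -[x](mulmxK uA) e mul0mx.
Qed.

Lemma posdef_inv n (S : 'M[R]_n) : posdef S -> posdef (invmx S).
Proof.
move=> hS; have uS := posdef_unit hS.
have e : (invmx S)^T = invmx S by rewrite trmx_inv hS.1.
have -> : invmx S = invmx S *m S *m (invmx S)^T by rewrite e mulVmx // mul1mx.
by apply: posdef_congr; rewrite ?unitmx_inv.
Qed.

Lemma posdefZ n a (S : 'M[R]_n) : 0 < a -> posdef S -> posdef (a *: S).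
Proof.
move=> a0 hS; apply: posdefI => [|x x0]; first by rewrite linearZ /= hS.1.
by rewrite qformZ mulr_gt0 // posdef_gt0.
Qed.

Lemma posdef_diag_gt0 n (S : 'M[R]_n) i : posdef S -> 0 < S i i.
Proof.
move=> hS; rewrite -qform_delta; apply: posdef_gt0 => //.
apply/eqP => /matrixP /(_ 0 i); rewrite !mxE !eqxx => /eqP.
by rewrite oner_eq0.
Qed.

(** * Cholesky factorization and determinant inequalities *)

Lemma cholesky n (S : 'M[R]_n) : posdef S ->
  exists2 A : 'M[R]_n, is_trig_mx A /\ (forall i, 0 < A i i) & S = A *m A^T.
Proof.
elim: n S => [|n IH] S hS.
  by exists 0; [split; [exact: mx0_is_trig | case] | apply/matrixP; case].
rewrite -[n.+1]/(1 + n)%N in S hS *.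
pose a := S 0 0; pose b : 'rV[R]_n := ursubmx S; pose C : 'M[R]_n := drsubmx S.
have a0 : 0 < a := posdef_diag_gt0 0 hS.
have eS : S = block_mx a%:M b b^T C.
  rewrite -[S]submxK; congr block_mx.
    by rewrite [LHS]mx11_scalar !mxE lshift0.
  by rewrite /b trmx_ursub hS.1.
(* The Schur complement of the corner entry [a]; the induction applies to it once it is positive
   definite. *)
pose C' := C - a^-1 *: (b^T *m b).
have hC' : posdef C'.
  apply: posdefI => [|y y0].
    rewrite /C' linearB linearZ /= trmx_mul trmxK; congr (_ - _).
    by rewrite /C trmx_drsub hS.1.
  (* For fixed [y] this first coordinate minimizes the form of [S], and the minimum is the form of
     [C'] at [y]. *)
  pose z : 'rV[R]_(1 + n) := row_mx (- a^-1 *: (y *m b^T)) y.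
  have z0 : z != 0.
    by apply: contra y0 => /eqP; rewrite -row_mx0 => /eq_row_mx[_ ->].
  have := posdef_gt0 hS z0; congr (_ < _).
  rewrite /qform eS /z mul_row_block tr_row_mx mul_row_col /C'.
  rewrite -!scalemxAl !mul_mx_scalar scalerA mulNr mulVf ?gt_eqF // scaleN1r addNr.
  rewrite mul0mx add0r mulmxBr -scalemxAr -mulmxA addrC scaleNr; congr ((_ *m _) 0 0).
have [A' [tA' dA'] eA'] := IH _ hC'.
have s0 : 0 < sqrt a by apply/RltP/sqrt_lt_R0/RltP.
have s2 : sqrt a * sqrt a = a by apply/sqrt_sqrt/RleP/ltW.
exists (block_mx (sqrt a)%:M 0 ((sqrt a)^-1 *: b^T) A').
  split; first by rewrite is_trig_block_mx // scalar_mx_is_trig eqxx.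
  move=> i; rewrite -[i]splitK; case: (split i) => j /=.
    by rewrite block_mxEul [j]ord1 mxE eqxx.
  by rewrite block_mxEdr.
rewrite tr_block_mx mulmx_block eS !tr_scalar_mx; congr block_mx.
- by rewrite trmx0 mulmx0 addr0 -scalar_mxM s2.
- rewrite mul0mx addr0 linearZ /= trmxK mul_scalar_mx scalerA divff ?scale1r //.
  by rewrite gt_eqF.
- by rewrite trmx0 mulmx0 addr0 mul_mx_scalar scalerA divff ?scale1r ?gt_eqF.
- rewrite linearZ /= trmxK -scalemxAl -scalemxAr scalerA -invfM s2 -eA' /C'.
  by rewrite addrC subrK.
Qed.

Lemma posdef_det_gt0 n (S : 'M[R]_n) : posdef S -> 0 < \det S.
Proof.
move=> /cholesky[A [tA dA] ->]; rewrite det_mulmx det_tr -expr2 exprn_gt0 //.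
by rewrite det_trig // prodr_gt0.
Qed.

(** For P = A A^T with A triangular, det P is the product of the A_ii^2 and tr P the sum of all
    A_ij^2, so ln t <= t - 1 on the diagonal suffices. Equality kills the off-diagonal entries and
    forces A_ii = 1. *)
Lemma ln_det_le_tr n (P : 'M[R]_n) : posdef P ->
  ln (\det P) <= \tr P - n%:R /\ (ln (\det P) = \tr P - n%:R -> P = 1%:M).
Proof.
move=> /cholesky[A [tA dA] ->].
have d2 i : 0 < A i i ^+ 2 by rewrite exprn_gt0.
have -> : \tr (A *m A^T) = \sum_i \sum_j A i j ^+ 2.
  by apply: eq_bigr => i _; rewrite mxE; apply: eq_bigr => j _; rewrite mxE expr2.
have -> : ln (\det (A *m A^T)) = \sum_i ln (A i i ^+ 2).
  by rewrite det_mulmx det_tr -expr2 det_trig // -prodrXl ln_prod.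
have -> : n%:R = \sum_(i < n) 1 :> R by rewrite sumr_const card_ord.
rewrite -sumrB.
have le1 i : ln (A i i ^+ 2) <= A i i ^+ 2 - 1 by exact: ln_le_sub1.
have sD i : \sum_j A i j ^+ 2 = A i i ^+ 2 + \sum_(j | j != i) A i j ^+ 2.
  by rewrite (bigD1 i).
have s0 i : 0 <= \sum_(j | j != i) A i j ^+ 2.
  by apply: sumr_ge0 => j _; exact: sqr_ge0.
have le2 i : ln (A i i ^+ 2) <= \sum_j A i j ^+ 2 - 1.
  by rewrite sD; move: (le1 i) (s0 i); lra.
split; first by apply: ler_sum => i _.
move=> e; have {}e i : ln (A i i ^+ 2) = \sum_j A i j ^+ 2 - 1.
  apply/eqP; rewrite eq_sym -subr_eq0; apply/eqP.
  have /psumr_eq0P : forall i : 'I_n, true ->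
      0 <= \sum_j A i j ^+ 2 - 1 - ln (A i i ^+ 2).
    by move=> k _; rewrite subr_ge0.
  by apply=> //; rewrite sumrB e subrr.
have A1 : A = 1%:M.
  apply/matrixP => i j; rewrite mxE.
  have := e i; rewrite sD => ei.
  have sz : \sum_(j | j != i) A i j ^+ 2 = 0.
    by move: (le1 i) (s0 i); lra.
  have Aii : A i i ^+ 2 = 1.
    by apply: ln_eq_sub1 => //; rewrite ei sz addr0.
  have [<-|ij] := eqVneq i j.
    apply/eqP; rewrite -(eqrXn2 (n := 2)) ?expr1n ?Aii ?ler01 //.
    exact: ltW.
  move/psumr_eq0P: sz => /(_ (fun k _ => sqr_ge0 _) j); rewrite eq_sym ij.
  by move=> /(_ isT)/eqP; rewrite sqrf_eq0 => /eqP ->.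
by rewrite A1 trmx1 mulmx1.
Qed.

(** The product G M need not be symmetric, but for G = A A^T the matrix A^T M A is positive definite
    with the same trace and determinant. *)
Lemma ln_det_mul_le_tr n (G M : 'M[R]_n) : posdef G -> posdef M ->
  ln (\det G * \det M) <= \tr (G *m M) - n%:R /\
  (ln (\det G * \det M) = \tr (G *m M) - n%:R -> M = invmx G).
Proof.
move=> hG hM; have uG := posdef_unit hG.
have [A _ eG] := cholesky hG; have uA : A \in unitmx.
  by move: uG; rewrite eG unitmx_mul => /andP[].
have uAT : A^T \in unitmx by rewrite unitmx_tr.
have hP := posdef_congr hM uAT; rewrite trmxK in hP.
have [le eq] := ln_det_le_tr hP; move: le eq.
have -> : \tr (A^T *m M *m A) = \tr (G *m M) by rewrite mxtrace_mulC mulmxA eG.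
have -> : \det (A^T *m M *m A) = \det G * \det M.
  by rewrite !det_mulmx eG det_mulmx; ring.
move=> le eq; split=> // /eq e.
have e2 : G *m M *m A = 1%:M *m A.
  by rewrite mul1mx eG -!mulmxA [A^T *m (M *m A)]mulmxA e mulmx1.
have GM : G *m M = 1%:M.
  by rewrite -[LHS](mulmxK uA) e2 mul1mx mulmxV.
by rewrite -[M](mulKmx uG) GM mulmx1.
Qed.

(** The preceding inequality against the diagonal matrix of the 1 / G_ii, whose product with G has
    trace exactly n. *)
Lemma hadamard_ln n (G : 'M[R]_n) : posdef G ->
  ln (\det G) <= \sum_i ln (G i i).
Proof.
move=> hG; have g0 i : 0 < G i i by exact: posdef_diag_gt0.
pose d : 'rV[R]_n := \row_i (G i i)^-1.
have dP : posdef (diag_mx d).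
  apply: posdefI => [|x x0]; first by rewrite tr_diag_mx.
  rewrite /qform mul_mx_diag mxE.
  have t0 i : 0 <= (\matrix_(k, j) (x k j * d 0 j)) 0 i * x^T i 0.
    by rewrite !mxE mulrAC -expr2 mulr_ge0 ?sqr_ge0 // invr_ge0 ltW.
  rewrite lt_def sumr_ge0 ?andbT => [|i _]; last exact: t0.
  apply: contra x0 => /eqP/psumr_eq0P h; apply/eqP/rowP => i.
  have /eqP := h (fun i _ => t0 i) i isT; rewrite !mxE mulrAC -expr2 mulf_eq0.
  by rewrite sqrf_eq0 invr_eq0 (gt_eqF (g0 i)) orbF => /eqP.
have [le _] := ln_det_mul_le_tr dP hG; move: le.
have -> : \tr (diag_mx d *m G) = n%:R.
  rewrite /mxtrace (eq_bigr (fun=> 1)) ?sumr_const ?card_ord // => i _.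
  by rewrite mul_diag_mx !mxE mulVf ?gt_eqF.
rewrite subrr lnM ?posdef_det_gt0 // det_diag ln_prod => [|i]; last first.
  by rewrite mxE invr_gt0.
have -> : \sum_i ln (d 0 i) = - \sum_i ln (G i i); last by lra.
by rewrite -sumrN; apply: eq_bigr => i _; rewrite mxE lnV.
Qed.

(** * Descent *)

Definition scatter n (X : seq 'rV[R]_n) (S : 'M[R]_n) : 'M[R]_n :=
  \sum_(x <- X) (qinv S x)^-1 *: (x^T *m x).

Lemma TmapE n (X : seq 'rV[R]_n) S :
  Tmap X S = (\tr (scatter X S))^-1 *: scatter X S.
Proof. by []. Qed.

Lemma FobjE n (X : seq 'rV[R]_n) S :
  Fobj X S = (\sum_(x <- X) ln (qinv S x)) / (size X)%:R + ln (\det S) / n%:R.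
Proof. by rewrite -!INR_natr. Qed.

Lemma qinv_gt0 n (S : 'M[R]_n) x : posdef S -> x != 0 -> 0 < qinv S x.
Proof. by move=> /posdef_inv; exact: posdef_gt0. Qed.

Lemma qinvZ n a (S : 'M[R]_n) x : a != 0 -> posdef S ->
  qinv (a *: S) x = a^-1 * qinv S x.
Proof.
move=> a0 /posdef_unit uS; have e : invmx (a *: S) = a^-1 *: invmx S.
  by rewrite invmxZ // unitmxZ // unitfE.
by rewrite /qinv e; exact: qformZ.
Qed.

Lemma qform_scatter n (X : seq 'rV[R]_n) S w :
  qform (scatter X S) w =
  \sum_(x <- X) (qinv S x)^-1 * (w *m x^T) 0 0 ^+ 2.
Proof.
by rewrite qform_sum; apply: eq_bigr => x _; rewrite qformZ qform_rank1.
Qed.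

Section Descent.
Variables (n : nat) (X : seq 'rV[R]_n).
Hypothesis X_neq0 : forall x, x \in X -> x != 0.
Hypothesis n_gt0 : (0 < n)%N.
Hypothesis X_gt0 : (0 < size X)%N.
(** The data span the space, in dual form; this is derived later from the subspace condition. *)
Hypothesis X_full : forall v : 'rV[R]_n,
  (forall x, x \in X -> (v *m x^T) 0 0 = 0) -> v = 0.

Let n0 : 0 < n%:R :> R. Proof. by rewrite ltr0n. Qed.
Let N0 : 0 < (size X)%:R :> R. Proof. by rewrite ltr0n. Qed.

(** The form at w is a positively weighted sum of the squares of w x^T, which vanishes only if w is
    orthogonal to all data. *)
Lemma scatter_posdef S : posdef S -> posdef (scatter X S).
Proof.
move=> hS; apply: posdefI => [|w w0].
  rewrite /scatter raddf_sum; apply: eq_bigr => x _.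
  by rewrite /= linearZ /= trmx_mul trmxK.
have t0 x : x \in X -> 0 <= (qinv S x)^-1 * (w *m x^T) 0 0 ^+ 2.
  by move=> /X_neq0 x0; rewrite mulr_ge0 ?sqr_ge0 // invr_ge0 ltW // qinv_gt0.
rewrite qform_scatter lt_def big_seq_cond sumr_ge0 ?andbT => [|x]; last first.
  by rewrite andbT; exact: t0.
apply: contra w0; rewrite -big_seq_cond => e; apply/eqP/X_full => x xX.
move: e; rewrite (big_rem _ xX) /= paddr_eq0 ?t0 //; last first.
  by rewrite big_seq sumr_ge0 // => y /mem_rem; exact: t0.
case/andP; rewrite mulf_eq0 invr_eq0 gt_eqF ?qinv_gt0 ?X_neq0 //=.
by rewrite sqrf_eq0 => /eqP.
Qed.

Lemma tr_inv_scatter S : posdef S -> \tr (invmx S *m scatter X S) = (size X)%:R.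
Proof.
move=> hS; rewrite /scatter mulmx_sumr raddf_sum /=.
rewrite big_seq (eq_bigr (fun=> 1)) => [|x xX].
  by rewrite -big_seq sumr_const_size.
rewrite -scalemxAr linearZ /= -qform_tr -[qform _ _]/(qinv S x) mulVf //.
by rewrite gt_eqF // qinv_gt0 ?X_neq0.
Qed.

Lemma mxtrace_posdef_gt0 (S : 'M[R]_n) : posdef S -> 0 < \tr S.
Proof.
move=> hS; rewrite /mxtrace (bigD1 (Ordinal n_gt0)) //= ltr_wpDr //.
  by apply: sumr_ge0 => i _; apply/ltW/posdef_diag_gt0.
exact: posdef_diag_gt0.
Qed.

Lemma Tmap_posdef S : posdef S -> posdef (Tmap X S).
Proof.
move=> /scatter_posdef hS; rewrite TmapE.
by apply: posdefZ => //; rewrite invr_gt0 mxtrace_posdef_gt0.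
Qed.

Lemma mxtrace_Tmap S : posdef S -> \tr (Tmap X S) = 1.
Proof.
move=> /scatter_posdef /mxtrace_posdef_gt0 h; rewrite TmapE linearZ /=.
by rewrite mulVf // gt_eqF.
Qed.

(** Scaling by a subtracts ln a from every ln q and adds n ln a to ln det; the two averages cancel.
    Hence the trace normalization in T does not affect F. *)
Lemma FobjZ a S : 0 < a -> posdef S -> Fobj X (a *: S) = Fobj X S.
Proof.
move=> a0 hS; have dS := posdef_det_gt0 hS.
rewrite !FobjE detZ lnM ?exprn_gt0 // ln_expn //.
have -> : \sum_(x <- X) ln (qinv (a *: S) x) =
          \sum_(x <- X) ln (qinv S x) - (size X)%:R * ln a.
  rewrite mulr_natl -sumr_const_size -sumrB.
  rewrite big_seq [RHS]big_seq; apply: eq_bigr => x xX.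
  rewrite qinvZ ?gt_eqF // lnM ?invr_gt0 ?qinv_gt0 ?X_neq0 // lnV //.
  by rewrite addrC.
by field; rewrite !gt_eqF.
Qed.

(** By scale invariance T S may be replaced by the multiple [M] of the scatter matrix. Neither term
    of F is larger at [M] than at S, so equality of F forces equal determinants, hence [M] = S. *)
Lemma Fobj_Tmap S : posdef S -> \tr S = 1 ->
  Fobj X (Tmap X S) <= Fobj X S /\ (Fobj X (Tmap X S) = Fobj X S -> Tmap X S = S).
Proof.
move=> hS trS; have hM := scatter_posdef hS.
have tM := mxtrace_posdef_gt0 hM.
have uM := posdef_unit hM.
(* The factor for which tr (S^-1 M) = n, so that the trace inequality reads ln det M <= ln det S. *)
pose c : R := n%:R / (size X)%:R; have c0 : 0 < c by rewrite divr_gt0.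
pose M := c *: scatter X S; have hM' : posdef M by exact: posdefZ.
have eF : Fobj X (Tmap X S) = Fobj X M by rewrite TmapE !FobjZ ?invr_gt0.
have eT : M = S -> Tmap X S = S.
  move=> e; rewrite TmapE; have eS : scatter X S = c^-1 *: S.
    by rewrite -[S in RHS]e scalerA mulVf ?scale1r ?gt_eqF.
  by rewrite eS mxtraceZ trS mulr1 scalerA invrK mulfV ?scale1r ?gt_eqF.
have [le eq] := ln_det_mul_le_tr (posdef_inv hS) hM'; move: le eq.
have -> : \tr (invmx S *m M) = n%:R.
  by rewrite -scalemxAr linearZ /= tr_inv_scatter // divfK // gt_eqF.
rewrite subrr invmxK det_inv lnM ?invr_gt0 ?posdef_det_gt0 // lnV ?posdef_det_gt0 //.
move=> le eq; rewrite eF !FobjE.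
have lq : \sum_(x <- X) ln (qinv M x) <= \sum_(x <- X) ln (qinv S x).
  (* The ratios sum to the trace of M^-1 times the scatter matrix, which is n / c = N. *)
  have e : \sum_(x <- X) (qinv M x / qinv S x - 1) = 0.
    rewrite sumrB; apply/eqP; rewrite subr_eq0; apply/eqP.
    rewrite sumr_const_size.
    transitivity (\tr (invmx M *m scatter X S)).
      rewrite [in RHS]/scatter mulmx_sumr raddf_sum /=; apply: eq_bigr => x _.
      by rewrite -scalemxAr linearZ /= -qform_tr mulrC.
    rewrite invmxZ ?unitmxZ ?unitfE ?gt_eqF // -scalemxAl mulVmx // linearZ /=.
    by rewrite mxtrace1 /c invf_div divfK // gt_eqF.
  rewrite -subr_le0 -sumrB -[leRHS]e big_seq [leRHS]big_seq.
  apply: ler_sum => x xX.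
  have [p1 p2] := (qinv_gt0 hM' (X_neq0 xX), qinv_gt0 hS (X_neq0 xX)).
  by rewrite -lnF //; apply/ln_le_sub1/divr_gt0.
have l1 : (\sum_(x <- X) ln (qinv M x)) / (size X)%:R <=
          (\sum_(x <- X) ln (qinv S x)) / (size X)%:R.
  by rewrite ler_wpM2r // invr_ge0 ltW.
have l2 : ln (\det M) / n%:R <= ln (\det S) / n%:R.
  by rewrite ler_wpM2r ?invr_ge0 ?(ltW n0) //; lra.
split; first exact: lerD.
move=> e; apply/eT/eq.
have : ln (\det M) / n%:R = ln (\det S) / n%:R by lra.
move/(mulIf (lt0r_neq0 _)) => /(_ _)->; first by rewrite addNr.
by rewrite invr_gt0.
Qed.

End Descent.

(** * Uniqueness of the fixed point *)

Lemma qformDZ n (S : 'M[R]_n) x y t : S^T = S ->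
  qform S (x + t *: y) = qform S x + 2 * t * (x *m S *m y^T) 0 0 + t ^+ 2 * qform S y.
Proof.
move=> hS; have e : (y *m S *m x^T) 0 0 = (x *m S *m y^T) 0 0.
  by rewrite -[in RHS]hS -[in RHS](trmxK x) -mulmxA -!trmx_mul [RHS]mxE.
have DE (A B : 'M[R]_1) : (A + B) 0 0 = A 0 0 + B 0 0 by rewrite mxE.
have ZE k (A : 'M[R]_1) : (k *: A) 0 0 = k * A 0 0 by rewrite mxE.
rewrite /qform linearD linearZ /= !mulmxDr !mulmxDl -!scalemxAl -!scalemxAr.
by rewrite -?scalemxAl !DE !ZE e; ring.
Qed.

(** A zero of a nonnegative form is a minimum, so the derivative in every direction vanishes
    there. *)
Lemma psd_qform_eq0 n (P : 'M[R]_n) x : P^T = P -> (forall y, 0 <= qform P y) ->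
  qform P x = 0 -> x *m P = 0.
Proof.
move=> sP hP x0; apply/rowP => j; rewrite [RHS]mxE.
pose y : 'rV[R]_n := delta_mx 0 j.
have -> : (x *m P) 0 j = (x *m P *m y^T) 0 0 by rewrite trmx_delta -colE [RHS]mxE.
set b := (_ *m _) 0 0; pose c := qform P y; have c0 : 0 <= c := hP y.
(* This multiple of y makes the form negative unless b = 0. *)
have := hP (x + (- b / (c + 1)) *: y); rewrite qformDZ // x0 -/b -/c.
have -> : 0 + 2 * (- b / (c + 1)) * b + (- b / (c + 1)) ^+ 2 * c =
  - (b ^+ 2 * ((c + 2) / (c + 1) ^+ 2)) by field; rewrite gt_eqF //; lra.
rewrite oppr_ge0 pmulr_lle0; last by rewrite divr_gt0 ?exprn_gt0 //; lra.
by move=> h; apply/eqP; rewrite -sqrf_eq0 eq_le h sqr_ge0.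
Qed.

(** Writing matrices for their forms, expand 0 <= A(x A^-1 - x B^-1) = A^-1(x) - 2 B^-1(x) + A(x
    B^-1) and bound the last term by B(x B^-1) = B^-1(x). *)
Lemma posdef_inv_anti n (A B : 'M[R]_n) : posdef A -> posdef B ->
  (forall x, qform A x <= qform B x) ->
  forall x, qform (invmx B) x <= qform (invmx A) x.
Proof.
move=> hA hB le x; have [uA uB] := (posdef_unit hA, posdef_unit hB).
pose y := x *m invmx B.
have sB : (invmx B)^T = invmx B := (posdef_inv hB).1.
have eB : qform B y = qform (invmx B) x.
  by rewrite -qform_congr sB mulVmx // mul1mx.
have sA : (invmx A)^T = invmx A := (posdef_inv hA).1.
have eA : qform A (x *m invmx A) = qform (invmx A) x.
  by rewrite -qform_congr sA mulVmx // mul1mx.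
have := posdef_ge0 (x *m invmx A + (-1) *: y) hA.
rewrite qformDZ ?hA.1 // eA mulmxKV //.
have -> : (x *m y^T) 0 0 = qform (invmx B) x.
  by rewrite /y trmx_mul sB /qform mulmxA.
by have := le y; rewrite eB; lra.
Qed.

Section FixedPoint.
Variables (n : nat) (X : seq 'rV[R]_n).
Hypothesis X_neq0 : forall x, x \in X -> x != 0.
Hypothesis n_gt0 : (0 < n)%N.
Hypothesis X_gt0 : (0 < size X)%N.
Hypothesis X_cond : forall L : 'M[R]_n, (1 <= \rank L <= n.-1)%N ->
  (n * count (fun x => (x <= L)%MS) X < size X * \rank L)%N.

(** The normalizing factor is forced: multiplying the fixed point equation by S^-1 and taking traces
    gives t N = n. *)
Lemma Tmap_fixed_scatter S : posdef S -> Tmap X S = S ->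
  S = (n%:R / (size X)%:R) *: scatter X S.
Proof.
move=> hS; rewrite TmapE; set t := (\tr _)^-1 => e.
have N0 : (size X)%:R != 0 :> R by rewrite pnatr_eq0 -lt0n.
have := tr_inv_scatter X_neq0 hS; move=> trS.
have et : t * (size X)%:R = n%:R.
  by rewrite -trS -mxtraceZ scalemxAr e mulVmx ?mxtrace1 ?posdef_unit.
by rewrite -et mulfK // e.
Qed.

Lemma Tmap_fixed_unique S1 S2 : posdef S1 -> posdef S2 -> \tr S1 = 1 -> \tr S2 = 1 ->
  Tmap X S1 = S1 -> Tmap X S2 = S2 -> S1 = S2.
Proof.
move=> h1 h2 tr1 tr2 /(Tmap_fixed_scatter h1) f1 /(Tmap_fixed_scatter h2) f2.
pose c : R := n%:R / (size X)%:R.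
have c0 : 0 < c by rewrite divr_gt0 ?ltr0n.
have q1 x : x \in X -> 0 < qinv S1 x by move=> /X_neq0; exact: qinv_gt0.
have q2 x : x \in X -> 0 < qinv S2 x by move=> /X_neq0; exact: qinv_gt0.
have [x0 x0X hmax] := exists_argmax (fun x => qinv S1 x / qinv S2 x) X_gt0.
pose r := qinv S1 x0 / qinv S2 x0.
have r0 : 0 < r by rewrite divr_gt0 ?q1 ?q2.
have le_q x : x \in X -> (qinv S2 x)^-1 <= r / qinv S1 x.
  by move=> xX; rewrite ler_pdivlMr ?q1 // mulrC; exact: hmax.
(* Up to the factor [c], the terms of the form of r S1 - S2 after both are expanded by the fixed
   point equation. They are nonnegative because [r] is the largest ratio. *)
pose d (w x : 'rV[R]_n) : R := (r / qinv S1 x - (qinv S2 x)^-1) * (w *m x^T) 0 0 ^+ 2.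
have d0 w x : x \in X -> 0 <= d w x.
  by move=> xX; rewrite mulr_ge0 ?sqr_ge0 // subr_ge0 le_q.
have sum_d w : qform (r *: S1) w - qform S2 w = c * \sum_(x <- X) d w x.
  rewrite qformZ [in qform S1 _]f1 [in qform S2 _]f2 !qformZ !qform_scatter.
  rewrite mulrCA -mulrBr mulr_sumr -sumrB; congr (_ * _).
  by apply: eq_bigr => x _; rewrite /d mulrBl mulrA.
have le_S w : qform S2 w <= qform (r *: S1) w.
  rewrite -subr_ge0 sum_d mulr_ge0 ?(ltW c0) // big_seq sumr_ge0 // => x.
  exact: d0.
have hr1 : posdef (r *: S1) by exact: posdefZ.
have eI : invmx (r *: S1) = r^-1 *: invmx S1.
  by rewrite invmxZ // posdef_unit.
pose P := invmx S2 - r^-1 *: invmx S1.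
have sP : P^T = P.
  by rewrite /P linearB linearZ /= (posdef_inv h1).1 (posdef_inv h2).1.
have eP x : qform P x = qinv S2 x - r^-1 * qinv S1 x by rewrite qformB qformZ.
have P0 x : 0 <= qform P x.
  by rewrite qformB subr_ge0 -eI; exact: posdef_inv_anti.
have x0P : x0 *m P = 0.
  apply: psd_qform_eq0 => //; rewrite eP /r invf_div divfK ?subrr //.
  by rewrite gt_eqF ?q1.
pose V := kermx P; pose W := kermx (invmx S1 *m V^T).
have mulE (u : 'rV[R]_n) (A : 'M[R]_n) j : (u *m A^T) 0 j = (u *m (row j A)^T) 0 0.
  by rewrite !mxE; apply: eq_bigr => k _; rewrite !mxE.
(* For v in [V] the vectors v S1^-1 and v S2^-1 agree up to [r], so the form of r S1 - S2 vanishes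
   at w = v S1^-1, and with it every [d w x]. Either its coefficient is zero, which puts x in [V],
   or x is orthogonal to w. *)
have X_VW x : x \in X -> (x <= V)%MS || (x <= W)%MS.
  move=> xX; have [//|xV] := boolP (x <= V)%MS; apply/sub_kermxP.
  rewrite mulmxA; apply/rowP => j; rewrite [RHS]mxE.
  pose v := row j V; pose w := v *m invmx S1.
  have vP : v *m P = 0 by apply/sub_kermxP; rewrite row_sub.
  have ew : w = r *: (v *m invmx S2).
    move: vP; rewrite /P mulmxBr -scalemxAr => /eqP; rewrite subr_eq0 => /eqP ->.
    by rewrite scalerA divff ?scale1r ?gt_eqF.
  have q1w : qform S1 w = (w *m v^T) 0 0.
    by rewrite /qform [w *m S1]mulmxKV ?posdef_unit // trmx_mul (posdef_inv h1).1 !mulmxA.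
  have q2w : qform S2 w = r * (w *m v^T) 0 0.
    rewrite /qform {1}ew -!scalemxAl mulmxKV ?posdef_unit // trmx_mul.
    by rewrite (posdef_inv h1).1 mulmxA mxE.
  have : c * \sum_(x <- X) d w x = 0 by rewrite -sum_d qformZ q1w q2w subrr.
  move/eqP; rewrite mulf_eq0 gt_eqF //= (big_rem _ xX) /= paddr_eq0 ?d0 //; last first.
    by rewrite big_seq sumr_ge0 // => y /mem_rem; exact: d0.
  case/andP => dx _; move: dx; rewrite /d mulf_eq0 sqrf_eq0 => /orP[|/eqP wx].
    rewrite subr_eq0 => /eqP e; case/negP: xV; apply/sub_kermxP.
    apply: psd_qform_eq0 => //; rewrite eP; apply/eqP; rewrite subr_eq0.
    rewrite -[qinv S2 x]invrK -e invf_div mulrC //.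
  transitivity ((x *m w^T) 0 0).
    by rewrite mulE /w (trmx_mul v) (posdef_inv h1).1 mulmxA.
  by rewrite -[x in x *m _]trmxK -trmx_mul mxE.
have rV : (0 < \rank V)%N.
  rewrite lt0n mxrank_eq0; apply/eqP => V0.
  have : (x0 <= V)%MS by apply/sub_kermxP.
  by rewrite V0 submx0; apply/negP/X_neq0.
have rW : (\rank W = n - \rank V)%N.
  rewrite mxrank_ker eqmxMfull ?mxrank_tr //.
  by rewrite row_full_unit unitmx_inv posdef_unit.
(* If [V] were proper, [V] and [W] would have complementary dimensions and cover the data, yet their
   counts would sum to less than N. *)
have rVn : (n <= \rank V)%N.
  rewrite leqNgt; apply/negP => rVn.
  have i1 : (1 <= \rank V <= n.-1)%N by lia.
  have i2 : (1 <= \rank W <= n.-1)%N by lia.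
  have := X_cond i1; have := X_cond i2.
  have : (size X <= count (fun x => (x <= V)%MS) X + count (fun x => (x <= W)%MS) X)%N.
    rewrite -count_predUI; apply: leq_trans (leq_addr _ _).
    by apply/eq_leq/esym/eqP; rewrite -all_count; apply/allP.
  by rewrite rW; nia.
have Pz : P = 0.
  have uV : row_full V by rewrite /row_full eqn_leq rank_leq_col.
  apply/eqP; rewrite -mxrank_eq0; have := mxrank_ker P; have := rank_leq_row P.
  by rewrite -/V; lia.
have eS : S2 = r *: S1.
  rewrite -[S2]invmxK; move/eqP: Pz; rewrite subr_eq0 => /eqP ->.
  by rewrite -eI invmxK.
by move: tr2; rewrite eS mxtraceZ tr1 mulr1 => ->; rewrite scale1r.
Qed.
End FixedPoint.

(** * Coercivity *)

(** The form is nonnegative at e_i + e_j and e_i - e_j, so 2 |G_ij| <= G_ii + G_jj. *)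
Lemma posdef_entry_bound n (G : 'M[R]_n) m i j : posdef G ->
  (forall k, G k k <= m) -> `|G i j| <= m.
Proof.
move=> hG hm.
have e t : 0 <= G i i + 2 * t * G i j + t ^+ 2 * G j j.
  have := posdef_ge0 (delta_mx 0 i + t *: delta_mx 0 j) hG.
  rewrite qformDZ ?hG.1 // !qform_delta trmx_delta -rowE -colE.
  by rewrite [col _ _ _ _]mxE [row _ _ _ _]mxE.
have := e 1; have := e (-1); rewrite sqrrN expr1n !mul1r => e1 e2.
by rewrite ler_norml; apply/andP; split; move: (hm i) (hm j); lra.
Qed.

Lemma det_entry_bound n (A : 'M[R]_n) m : (forall i j, `|A i j| <= m) ->
  `|\det A| <= n`!%:R * m ^+ n.
Proof.
move=> hA; apply: le_trans (ler_norm_sum _ _ _) _.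
apply: (@le_trans _ _ (\sum_(s : 'S_n) m ^+ n)).
  apply: ler_sum => s _; rewrite normrM normr_sign mul1r normr_prod.
  rewrite -[n in leRHS]card_ord -prodr_const; apply: ler_prod => i _.
  by rewrite normr_ge0 hA.
by rewrite sumr_const card_Sn mulr_natl.
Qed.

(** Cramer's rule: an entry of the inverse is, up to sign, a minor of size n - 1 divided by det
    G. *)
Lemma invmx_entry_bound n (G : 'M[R]_n) m i j : posdef G ->
  (forall k, G k k <= m) ->
  `|invmx G i j| <= n.-1`!%:R * m ^+ n.-1 / \det G.
Proof.
move=> hG hm; have dG := posdef_det_gt0 hG.
rewrite /invmx posdef_unit // !mxE normrM gtr0_norm ?invr_gt0 // mulrC.
rewrite ler_pM2r ?invr_gt0 // /cofactor normrM normr_sign mul1r.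
by apply: det_entry_bound => k l; rewrite !mxE; exact: posdef_entry_bound.
Qed.

(** * Abel summation, greedy bases and their flags *)

Lemma abel_flag_sum (l : nat -> R) k :
  \sum_(j < k) (k%:R - j%:R) * (l j.+1 - l j) =
  \sum_(j < k.+1) l j - k.+1%:R * l 0%N.
Proof.
elim: k => [|k IH]; first by rewrite big_ord0 big_ord1 mul1r subrr.
rewrite (eq_bigr (fun j : 'I_k.+1 => (k%:R - j%:R) * (l j.+1 - l j) +
   (l j.+1 - l j))) => [|j _]; last by rewrite -(natr1 k); ring.
rewrite big_split /= big_ord_recr /= subrr mul0r addr0 IH.
have -> : \sum_(j < k.+1) (l j.+1 - l j) = l k.+1 - l 0%N.
  by rewrite -(big_mkord xpredT (fun j => l j.+1 - l j)) telescope_sumr.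
by rewrite [in RHS]big_ord_recr /= -[k.+2%:R]natr1; ring.
Qed.

(** The span of the [b i] with i < j; index j is excluded, so that [b j] can be tested against its
    predecessors. *)
Fixpoint flag n (b : nat -> 'rV[R]_n) (j : nat) : 'M[R]_n :=
  if j is k.+1 then (flag b k + b k)%MS else 0.

Lemma flagS n (b : nat -> 'rV[R]_n) i j : (i <= j)%N -> (flag b i <= flag b j)%MS.
Proof.
elim: j => [|j IH]; first by rewrite leqn0 => /eqP ->.
rewrite leq_eqVlt => /predU1P[-> //|]; rewrite ltnS => /IH h.
exact: submx_trans h (addsmxSl _ _).
Qed.

Lemma eq_flag n (b c : nat -> 'rV[R]_n) j :
  (forall i, (i < j)%N -> b i = c i) -> flag b j = flag c j.
Proof.
elim: j => //= j IH h; rewrite IH => [|i ij]; last exact/h/ltnW.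
by rewrite h.
Qed.

Definition greedy n (X : seq 'rV[R]_n) (f : 'rV[R]_n -> R) (b : nat -> 'rV[R]_n) m :=
  forall j, (j < m)%N -> [/\ b j \in X, ~~ (b j <= flag b j)%MS &
    forall x, x \in X -> ~~ (x <= flag b j)%MS -> f (b j) <= f x].

Lemma greedy_rank n (X : seq 'rV[R]_n) f b m j :
  greedy X f b m -> (j <= m)%N -> \rank (flag b j) = j.
Proof.
move=> gb; elim: j => [|j IH] jm /=; first by rewrite mxrank0.
have [_ nb _] := gb j jm; have {}IH := IH (ltnW jm).
apply/eqP; rewrite eqn_leq; apply/andP; split.
  have [le _] := mxrank_adds_leqif (flag b j) (b j); apply: leq_trans le _.
  by rewrite IH; apply: leq_trans (leq_add (leqnn _) (rank_leq_row _)) _; rewrite addn1.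
rewrite -[j in (j < _)%N]IH; apply: rank_ltmx; rewrite /ltmx addsmxSl /=.
by apply: contra nb => /(submx_trans (addsmxSr _ _)).
Qed.

Section Coercivity.
Variables (k : nat) (X : seq 'rV[R]_k.+1).
Local Notation n := k.+1.
Hypothesis X_neq0 : forall x, x \in X -> x != 0.
Hypothesis X_gt0 : (0 < size X)%N.
Hypothesis X_cond : forall L : 'M[R]_n, (1 <= \rank L <= n.-1)%N ->
  (n * count (fun x => (x <= L)%MS) X < size X * \rank L)%N.

(** Otherwise all N points lie in L, which is nonzero as they are, and the condition would give n N
    < N rank L. *)
Lemma X_not_sub (L : 'M[R]_n) : (\rank L < n)%N -> exists2 x, x \in X & ~~ (x <= L)%MS.
Proof.
move=> rL; apply/hasP; apply: contraT; rewrite -all_predC => /allP h.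
have {}h x : x \in X -> (x <= L)%MS by move=> /h /=; rewrite negbK.
have L0 : (1 <= \rank L)%N.
  case: X X_neq0 X_gt0 h => // x s h0 _ /(_ x (mem_head _ _)) xL.
  rewrite lt0n mxrank_eq0; apply: contraL xL => /eqP ->.
  by rewrite submx0 h0 ?mem_head.
have /X_cond : (1 <= \rank L <= n.-1)%N by rewrite L0.
have -> : count (fun x => (x <= L)%MS) X = size X.
  by apply/eqP; rewrite -all_count; apply/allP.
by rewrite mulnC ltn_mul2l X_gt0 /= ltnNge (ltnW rL).
Qed.

Lemma greedy_exists f m : (m <= n)%N -> exists b, greedy X f b m.
Proof.
elim: m => [|m IH] mn; first by exists (fun=> 0).
have [b gb] := IH (ltnW mn).
have rb := greedy_rank gb (leqnn m).
pose Y := [seq x <- X | ~~ (x <= flag b m)%MS].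
have /(exists_argmax (fun x => - f x))[x] : (0 < size Y)%N.
  have [|x xX xb] := @X_not_sub (flag b m); first by rewrite rb.
  by rewrite size_filter -has_count; apply/hasP; exists x.
rewrite mem_filter => /andP[xb xX] hx.
(* Changing index [m] alone leaves all flags up to [m], hence the earlier choices, intact. *)
pose c i := if i == m then x else b i.
have ec j : (j <= m)%N -> flag c j = flag b j.
  by move=> jm; apply: eq_flag => i ij; rewrite /c ltn_eqF // (leq_trans ij).
exists c => j; rewrite ltnS leq_eqVlt => /predU1P[-> | jm].
  rewrite ec // /c eqxx; split=> // y yX yb; rewrite -lerN2; apply: hx.
  by rewrite mem_filter yb.
by rewrite ec ?(ltnW jm) // /c ltn_eqF //; exact: gb.
Qed.

(** Each f x is at least a staircase in the levels f (b j). On summing over the data, the subspace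
    condition bounds from below how many points climb each step, and Abel summation returns to the
    sum over the basis. *)
Lemma greedy_sum_ge (f : 'rV[R]_n -> R) : exists b : nat -> 'rV[R]_n,
  [/\ forall j, (j < n)%N -> b j \in X, \matrix_(i < n) b i \in unitmx,
      forall j, (j < n)%N -> f (b 0%N) <= f (b j) <= f (b k) &
   (size X)%:R * \sum_(j < n) f (b j) + (f (b k) - f (b 0%N)) <=
     n%:R * \sum_(x <- X) f x].
Proof.
have [b gb] := greedy_exists f (leqnn n); exists b.
pose l j := f (b j); pose N : R := (size X)%:R.
have bX j : (j < n)%N -> b j \in X by move=> /gb[].
(* [b i] lies outside [flag b i], hence outside the smaller [flag b j], and so was a candidate at
   stage [j]. *)
have lS j i : (j <= i)%N -> (i < n)%N -> l j <= l i.
  move=> ji iN; have [_ _ hj] := gb j (leq_ltn_trans ji iN).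
  have [iX ni _] := gb i iN; apply: hj => //.
  by apply: contra ni => h; exact: submx_trans h (flagS _ ji).
(* If x is outside flag b m, the indicators are all 1
   and the sum telescopes to l m <= f x; otherwise the last term vanishes. *)
have level x m : x \in X -> (m < n)%N ->
   l 0%N + \sum_(j < m) (~~ (x <= flag b j.+1)%MS)%:R * (l j.+1 - l j) <= f x.
  move=> xX; elim: m => [|m IH] mn.
    have [_ _] := gb 0%N mn; rewrite big_ord0 addr0; apply=> //=.
    by rewrite submx0 X_neq0.
  have [xm|xm] := boolP (x <= flag b m.+1)%MS.
    by rewrite big_ord_recr /= xm /= mul0r addr0 IH // ltnW.
  have [_ _ /(_ x xX xm)] := gb m.+1 mn; apply: le_trans.
  rewrite (eq_bigr (fun j : 'I_m.+1 => l j.+1 - l j)) => [|j _].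
    by rewrite -(big_mkord xpredT (fun j => l j.+1 - l j)) telescope_sumr // subrKC.
  rewrite (_ : ~~ _) ?mul1r //; apply: contra xm => h.
  by apply: submx_trans h (flagS _ _).
split=> //.
- rewrite -row_full_unit -sub1mx.
  have full : (1%:M <= flag b n)%MS.
    by rewrite sub1mx /row_full (greedy_rank gb).
  apply: submx_trans full _.
  have h m : (m <= n)%N -> (flag b m <= \matrix_(i < n) b i)%MS.
    elim: m => [|m IH] mn /=; first exact: sub0mx.
    rewrite addsmx_sub IH 1?ltnW //=.
    have -> : b m = row (Ordinal mn) (\matrix_(i < n) b i) by rewrite rowK.
    exact: row_sub.
  exact: h.
- by move=> j jn; apply/andP; split; apply: lS.
pose cnt j := count (fun x => (x <= flag b j.+1)%MS) X.
have sumle : N * l 0%N + \sum_(j < k) (N - (cnt j)%:R) * (l j.+1 - l j)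
     <= \sum_(x <- X) f x.
  have : \sum_(x <- X) (l 0%N + \sum_(j < k) (~~ (x <= flag b j.+1)%MS)%:R *
           (l j.+1 - l j)) <= \sum_(x <- X) f x.
    by rewrite big_seq [leRHS]big_seq; apply: ler_sum => x xX; exact: level.
  rewrite big_split /= sumr_const_size exchange_big /= mulr_natl.
  congr (_ + _ <= _); apply: eq_bigr => j _; rewrite -mulr_suml; congr (_ * _).
  rewrite /cnt /N -(count_predC (fun x => (x <= flag b j.+1)%MS)) natrD addrC addKr.
  by rewrite -sum1_count natr_sum [RHS]big_mkcond; apply: eq_bigr => x _ /=; case: ifP.
(* Counts are integers, so the strict condition leaves a margin of 1; summed against the increments
   it yields the extra f (b k) - f (b 0). *)
have cle (j : 'I_k) : N * (k%:R - j%:R) + 1 <= n%:R * (N - (cnt j)%:R).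
  have /X_cond : (1 <= \rank (flag b j.+1) <= n.-1)%N.
    by rewrite (greedy_rank gb) ?ltn_ord //= ltnS ltnW.
  rewrite (greedy_rank gb) -/(cnt j); last by rewrite ltnS ltnW.
  rewrite -(ltr_nat R) !natrM => h.
  have {}h : n%:R * (cnt j)%:R + 1 <= N * j.+1%:R by rewrite /N -!natrM natr1 ler_nat -(ltr_nat R) !natrM.
  by rewrite -(natr1 j) in h; rewrite -(natr1 k) in h *; lra.
apply: (@le_trans _ _ (n%:R * (N * l 0%N) +
   \sum_(j < k) (N * (k%:R - j%:R) + 1) * (l j.+1 - l j))).
  rewrite (eq_bigr (fun j : 'I_k => N * ((k%:R - j%:R) * (l j.+1 - l j)) +
    (l j.+1 - l j))) => [|j _]; last by rewrite mulrDl mul1r mulrA.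
  rewrite big_split /= -mulr_sumr abel_flag_sum.
  have -> : \sum_(j < k) (l j.+1 - l j) = l k - l 0%N.
    by rewrite -(big_mkord xpredT (fun j => l j.+1 - l j)) telescope_sumr.
  by rewrite -/N le_eqVlt; apply/orP; left; apply/eqP; rewrite /l; ring.
apply: le_trans (ler_wpM2l (ler0n _ _) sumle); rewrite mulrDr lerD2l mulr_sumr.
apply: ler_sum => j _; rewrite mulrA ler_wpM2r ?cle // subr_ge0.
by apply: lS; rewrite ?ltnS.
Qed.

(** Only finitely many matrices have all their rows in the data. This makes the coercivity constant
    uniform although the greedy basis depends on S. *)
Lemma matrix_rows_bound (g : 'M[R]_n -> R) :
  exists C : R, forall B, (forall i, row i B \in X) -> g B <= C.
Proof.
pose T := {ffun 'I_n -> 'I_(size X)}.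
pose M (t : T) := \matrix_(i < n) nth 0 X (t i).
exists (\sum_t `|g (M t)|) => B hB.
have iX i : (index (row i B) X < size X)%N by rewrite index_mem.
have -> : B = M [ffun i => Ordinal (iX i)].
  by apply/row_matrixP => i; rewrite rowK ffunE /= nth_index.
by rewrite (bigD1 [ffun i => Ordinal (iX i)]) //= ler_wpDr ?ler_norm // sumr_ge0.
Qed.

Lemma Fobj_coercive c : exists2 e : R, 0 < e &
  forall S, posdef S -> \tr S = 1 -> Fobj X S <= c -> e <= \det S.
Proof.
pose N : R := (size X)%:R; have N1 : 1 <= N by rewrite ler1n.
(* With m the largest q(b_j) and G the Gram matrix of the basis: [C0] bounds the slack in the
   inequalities, [K] the ratio m^n / det G, [beta] the effect of the basis when S is recovered from
   G^-1, and [g] finally 1 / det S. *)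
pose C0 (B : 'M[R]_n) : R := n%:R * N * c - N * ln (\det B ^+ 2).
pose K B : R := exp (n.+1%:R * C0 B).
pose beta (B : 'M[R]_n) : R := \sum_i \sum_j \sum_l `|B l i| * `|B j i|.
pose g B : R := (k`!%:R * K B * beta B) ^+ n / \det B ^+ 2.
have [C hC] := matrix_rows_bound g.
exists (`|C| + 1)^-1 => [|S hS trS hF]; first by rewrite invr_gt0 ltr_wpDl.
have dS := posdef_det_gt0 hS.
rewrite -[\det S]invrK lef_pV2 ?posrE ?invr_gt0 //; last by rewrite ltr_wpDl.
have [b [bX uB b_le sum_le]] := greedy_sum_ge (fun x => ln (qinv S x)).
pose B := \matrix_(i < n) b i; rewrite -/B in uB.
suff : (\det S)^-1 <= g B.
  move=> h; apply: le_trans h _; apply: (@le_trans _ _ C); last first.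
    by rewrite (le_trans (ler_norm C)) // ler_wpDr.
  by apply: hC => i; rewrite rowK bX.
have dB : 0 < \det B ^+ 2 by rewrite exprn_even_gt0 //= -unitfE -unitmxE.
pose G := B *m invmx S *m B^T.
have hG : posdef G by apply: posdef_congr => //; exact: posdef_inv.
have dG := posdef_det_gt0 hG.
have eG : \det G = \det B ^+ 2 / \det S.
  by rewrite !det_mulmx det_tr det_inv; ring.
have Gii i : G i i = qinv S (b i).
  by rewrite -qform_delta qform_congr -rowE rowK.
have q0 j : (j < n)%N -> 0 < qinv S (b j).
  by move=> /bX /X_neq0; exact: qinv_gt0.
pose m := qinv S (b k); have m0 : 0 < m by exact: q0.
have Gm i : G i i <= m.
  by rewrite Gii; apply: ln_le_inv; rewrite ?q0 //; case/andP: (b_le i (ltn_ord i)).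
have had := hadamard_ln hG.
have eL : \sum_i ln (G i i) = \sum_(j < n) ln (qinv S (b j)).
  by apply: eq_bigr => i _; rewrite Gii.
have lnG : ln (\det G) = ln (\det B ^+ 2) - ln (\det S) by rewrite eG lnF.
have sumF : n%:R * \sum_(x <- X) ln (qinv S x) + N * ln (\det S) <= n%:R * N * c.
  have -> : n%:R * \sum_(x <- X) ln (qinv S x) + N * ln (\det S) = n%:R * N * Fobj X S.
    by rewrite FobjE -/N; field; rewrite nat1r !pnatr_eq0 -!lt0n X_gt0.
  by rewrite ler_wpM2l // mulr_ge0 // ler0n.
rewrite eL in had; set L := \sum_(j < n) _ in had sum_le.
have /andP[b0k _] := b_le k (ltnSn k).
(* Both summands are nonnegative, the first by Hadamard's inequality, so each is at most [C0 B]. *)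
have slack : N * (L - ln (\det G)) + (ln m - ln (qinv S (b 0%N))) <= C0 B.
  by rewrite /C0 lnG /m; move: sum_le sumF; rewrite -/N; lra.
have slack1 : ln m - ln (qinv S (b 0%N)) <= C0 B.
  have : 0 <= N * (L - ln (\det G)) by rewrite mulr_ge0 //; lra.
  by lra.
have slack2 : L - ln (\det G) <= C0 B.
  have : L - ln (\det G) <= N * (L - ln (\det G)) by rewrite ler_peMl //; lra.
  by rewrite -/m in b0k; lra.
have L_ge : n%:R * ln (qinv S (b 0%N)) <= L.
  have -> : n%:R * ln (qinv S (b 0%N)) = \sum_(j < n) ln (qinv S (b 0%N)).
    by rewrite sumr_const card_ord mulr_natl.
  by apply: ler_sum => j _; case/andP: (b_le j (ltn_ord j)).
have K0 : 0 < K B by exact/RltP/exp_pos.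
have lnK : ln (K B) = n.+1%:R * C0 B by exact: ln_exp.
(* The ratio of m^n to the product of the q(b_j) is at most exp (n C0), and that of the product to
   det G at most exp C0; hence the factor n + 1 in [K]. *)
have mdet : m ^+ n <= K B * \det G.
  apply: ln_le_inv; rewrite ?exprn_gt0 ?mulr_gt0 //.
  rewrite ln_expn // lnM // lnK -natr1.
  have : n%:R * (ln m - ln (qinv S (b 0%N))) <= n%:R * C0 B by rewrite ler_wpM2l.
  by lra.
have invG i j : `|invmx G i j| <= k`!%:R * K B / m.
  apply: le_trans (invmx_entry_bound i j hG Gm) _ => /=.
  rewrite -!mulrA ler_wpM2l ?ler0n // ler_pdivrMr // mulrAC ler_pdivlMr //.
  by rewrite -exprSr.
have eS : S = B^T *m invmx G *m B.
  have e : G *m (invmx B)^T = B *m invmx S.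
    by rewrite /G -mulmxA -trmx_mul mulVmx // trmx1 mulmx1.
  have uG := posdef_unit hG.
  have e2 : (invmx B)^T = invmx G *m B *m invmx S by rewrite -mulmxA -e mulKmx.
  have e3 : S = B^T *m ((invmx B)^T *m S).
    by rewrite mulmxA -trmx_mul mulVmx // trmx1 mul1mx.
  by rewrite {1}e3 e2 mulmxKV ?posdef_unit // mulmxA.
(* The trace fixes the scale: 1 = tr S is at most a constant over m, which bounds m from above. *)
have m_le : m <= k`!%:R * K B * beta B.
  have : \tr S <= k`!%:R * K B / m * beta B.
    rewrite eS /mxtrace /beta mulr_sumr; apply: ler_sum => i _.
    rewrite mxE mulr_sumr; apply: ler_sum => j _.
    rewrite mxE mulr_suml mulr_sumr; apply: ler_sum => l _.
    apply: le_trans (ler_norm _) _; rewrite !normrM mxE mulrAC [leRHS]mulrC.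
    by rewrite ler_wpM2l ?mulr_ge0.
  by rewrite trS mulrAC ler_pdivlMr // mul1r.
have G_le : \det G <= m ^+ n.
  apply: ln_le_inv; rewrite ?exprn_gt0 // ln_expn //; apply: le_trans had _.
  rewrite mulr_natl -[n in _ *+ n]card_ord -sumr_const; apply: ler_sum => j _.
  by case/andP: (b_le j (ltn_ord j)).
have -> : (\det S)^-1 = \det G / \det B ^+ 2 by rewrite eG mulrAC divff ?mul1r ?gt_eqF.
rewrite /g ler_pM2r ?invr_gt0 //; apply: le_trans G_le _.
by rewrite lerXn2r // ?nnegrE ?(ltW m0) // (le_trans (ltW m0)).
Qed.
End Coercivity.

(** * Convergence of sequences of matrices *)

Lemma Un_cvP (u : nat -> R) (l : R) : Un_cv u l <->
  forall e, 0 < e -> exists N, forall k, (N <= k)%N -> `|u k - l| < e.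
Proof.
split=> h e /RltP e0; have [N hN] := h e e0; exists N => k.
  by move=> /ssrnat.leP /hN /RltP.
by move=> /ssrnat.leP /hN ?; exact/RltP.
Qed.

Lemma Un_cv_const (c : R) : Un_cv (fun=> c) c.
Proof. by apply/Un_cvP => e e0; exists 0%N => k _; rewrite subrr normr0. Qed.

Lemma Un_cvD (u v : nat -> R) (l m : R) : Un_cv u l -> Un_cv v m ->
  Un_cv (fun k => u k + v k) (l + m).
Proof. exact: CV_plus. Qed.

Lemma Un_cvM (u v : nat -> R) (l m : R) : Un_cv u l -> Un_cv v m ->
  Un_cv (fun k => u k * v k) (l * m).
Proof. exact: CV_mult. Qed.

Lemma Un_cvV (u : nat -> R) (l : R) : l != 0 -> Un_cv u l ->
  Un_cv (fun k => (u k)^-1) l^-1.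
Proof.
move=> /eqP l0; apply: (@continuity_seq Rinv).
exact: (continuity_pt_inv id l (derivable_continuous_pt _ _ (derivable_pt_id l)) l0).
Qed.

Lemma Un_cv_ln (u : nat -> R) (l : R) : 0 < l -> Un_cv u l ->
  Un_cv (fun k => ln (u k)) (ln l).
Proof.
move=> /RltP l0; apply: continuity_seq; apply: derivable_continuous_pt.
by exists (Rinv l); apply: derivable_pt_lim_ln.
Qed.

Lemma Un_cv_ext (u v : nat -> R) (l : R) : u =1 v -> Un_cv u l -> Un_cv v l.
Proof.
by move=> uv /Un_cvP h; apply/Un_cvP => e /h[N hN]; exists N => k /hN; rewrite uv.
Qed.

(** Stated for any operation that respects limits, so that it serves both the sums and the products
    in the Leibniz formula. *)
Lemma Un_cv_big (op : R -> R -> R) (x0 : R) (I : Type) (r : seq I) (P : pred I)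
    (u : nat -> I -> R) (l : I -> R) :
  (forall u v l m, Un_cv u l -> Un_cv v m -> Un_cv (fun k => op (u k) (v k)) (op l m)) ->
  (forall i, Un_cv (u^~ i) (l i)) ->
  Un_cv (fun k => \big[op/x0]_(i <- r | P i) u k i) (\big[op/x0]_(i <- r | P i) l i).
Proof.
move=> hop ul; elim: r => [|i r IH].
  by rewrite big_nil; apply: Un_cv_ext (Un_cv_const x0) => k; rewrite big_nil.
rewrite big_cons; apply: (@Un_cv_ext (fun k => if P i then
    op (u k i) (\big[op/x0]_(i <- r | P i) u k i) else
    \big[op/x0]_(i <- r | P i) u k i)) => [k|]; first by rewrite big_cons.
by case: ifP => // _; apply: hop.
Qed.

Lemma Un_cv_le (u v : nat -> R) (l m : R) : (forall k, u k <= v k) ->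
  Un_cv u l -> Un_cv v m -> l <= m.
Proof.
move=> uv /Un_cvP ul /Un_cvP vm; rewrite leNgt; apply/negP => ml.
have e0 : 0 < (l - m) / 2 by lra.
have [[N hN] [M hM]] := (ul _ e0, vm _ e0).
have := hN _ (leq_maxl N M); have := hM _ (leq_maxr N M).
move: (uv (maxn N M)); set x := u _; set y := v _.
by rewrite !ltr_norml => xy /andP[_ a] /andP[b _]; lra.
Qed.

Lemma Un_cv_unique (u : nat -> R) (l m : R) : Un_cv u l -> Un_cv u m -> l = m.
Proof. exact: UL_sequence. Qed.

(** * Subsequences and compactness *)

Definition extraction (phi : nat -> nat) := forall k, (phi k < phi k.+1)%N.

Lemma extraction_ge phi : extraction phi -> forall k, (k <= phi k)%N.
Proof. by move=> h; elim=> // k IH; exact: leq_ltn_trans IH (h k). Qed.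

Lemma extraction_mono phi i j : extraction phi -> (i < j)%N -> (phi i < phi j)%N.
Proof.
move=> h; elim: j => // j IH; rewrite ltnS leq_eqVlt => /predU1P[-> //|/IH].
by move=> ij; exact: ltn_trans (h j).
Qed.

Lemma Un_cv_extract (u : nat -> R) l phi : extraction phi -> Un_cv u l ->
  Un_cv (fun k => u (phi k)) l.
Proof.
move=> hphi /Un_cvP h; apply/Un_cvP => e /h[N hN]; exists N => k Nk.
by apply: hN; apply: leq_trans Nk (extraction_ge hphi k).
Qed.

Lemma exists_extraction (Q : nat -> nat -> Prop) :
  (forall k N, exists2 m, (N <= m)%N & Q k m) ->
  exists2 phi, extraction phi & forall k, Q k (phi k).
Proof.
move=> h; pose F k N := constructive_indefinite_description _
  (ex2_ind (fun m a b => ex_intro (fun m => (N <= m)%N /\ Q k m) m (conj a b)) (h k N)).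
(* Searching from the successor of the previous index makes the chosen indices strictly
   increasing. *)
pose phi := fix f k := if k is j.+1 then sval (F k (f j).+1) else sval (F 0%N 0%N).
exists phi => [k | [|k]] /=.
- by case: (svalP (F k.+1 (phi k).+1)).
- by case: (svalP (F 0%N 0%N)).
- by case: (svalP (F k.+1 (phi k).+1)).
Qed.

(** Compactness of [-C, C] gives a cluster point; taking the k-th chosen term within 1 / (k + 1) of
    it gives the subsequence. *)
Lemma bolzano_weierstrass (u : nat -> R) (C : R) : (forall k, `|u k| <= C) ->
  exists2 phi, extraction phi & exists l, Un_cv (fun k => u (phi k)) l.
Proof.
move=> uC; have [|l hl] := @Bolzano_Weierstrass u _ (compact_P3 (- C) C).
  by move=> k; move: (uC k); rewrite ler_norml => /andP[/RleP a /RleP b].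
have [|phi hphi cphi] := @exists_extraction (fun k m => `|u m - l| < k.+1%:R^-1).
  move=> k N; have p0 : Rlt 0 (k.+1%:R^-1 : R) by apply/RltP; rewrite invr_gt0 ltr0n.
  have [|m [/ssrnat.leP Nm hm]] := hl (disc l (mkposreal _ p0)) N.
    by exists (mkposreal _ p0).
  by exists m => //; apply/RltP.
exists phi => //; exists l; apply/Un_cvP => e e0.
have [N [/RltP hN /ssrnat.ltP N0]] := archimed_cor1 e (RltP _ _ e0).
exists N => k Nk; apply: lt_trans (cphi k) (le_lt_trans _ hN).
by rewrite -[Rinv _]/((INR N)^-1) INR_natr lef_pV2 ?posrE ?ltr0n // ler_nat ltnW.
Qed.

(** Entries are treated one after another; a further extraction keeps the convergence already
    obtained. *)
Lemma mx_compact m n (u : nat -> 'M[R]_(m, n)) (C : R) :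
  (forall k i j, `|u k i j| <= C) ->
  exists2 phi, extraction phi & exists l, mx_cv (fun k => u (phi k)) l.
Proof.
move=> uC.
have [phi hphi cphi] : exists2 phi, extraction phi & forall p, p \in enum {: 'I_m * 'I_n} ->
    exists l, Un_cv (fun k => u (phi k) p.1 p.2) l.
  elim: (enum _) => [|p s [phi hphi IH]]; first by exists id.
  have [psi hpsi [l hl]] := bolzano_weierstrass (fun k => uC (phi k) p.1 p.2).
  exists (phi \o psi) => [k|q]; first exact: extraction_mono hphi (hpsi k).
  rewrite inE => /predU1P[-> | /IH[l' hl']]; first by exists l.
  exists l'; exact: (@Un_cv_extract (fun k => u (phi k) q.1 q.2)).
exists phi => //.
have {}cphi i j : exists l, Un_cv (fun k => u (phi k) i j) l.
  by apply: (cphi (i, j)); rewrite mem_enum.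
pose f i j := constructive_indefinite_description _ (cphi i j).
by exists (\matrix_(i, j) sval (f i j)) => i j; rewrite mxE; exact: svalP (f i j).
Qed.

(** If an entry did not converge to that of L, a subsequence would keep it at distance at least [e];
    yet that subsequence has a convergent one, whose limit is L. *)
Lemma mx_cv_clusters m n (u : nat -> 'M[R]_(m, n)) (C : R) L :
  (forall k i j, `|u k i j| <= C) ->
  (forall phi l, extraction phi -> mx_cv (fun k => u (phi k)) l -> l = L) ->
  mx_cv u L.
Proof.
move=> uC hL i j; apply/Un_cvP => e e0; apply: NNPP => hn.
have [|psi hpsi cpsi] := @exists_extraction (fun _ k => e <= `|u k i j - L i j|).
  move=> _ N; apply: NNPP => hm; apply: hn; exists N => k Nk.
  by rewrite ltNge; apply/negP => ek; apply: hm; exists k.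
have [phi hphi [l hl]] := mx_compact (fun k => uC (psi k)).
have lL : l = L.
  by apply: (hL (psi \o phi)) => // k; exact: extraction_mono hpsi (hphi k).
move: hl; rewrite lL => hl; have /Un_cvP /(_ e e0) [N hN] := hl i j.
by have := hN N (leqnn N); rewrite ltNge cpsi.
Qed.

(** * Continuity of the matrix operations *)

Lemma mx_cvM m n p (u : nat -> 'M[R]_(m, n)) (v : nat -> 'M[R]_(n, p)) l l' :
  mx_cv u l -> mx_cv v l' -> mx_cv (fun k => u k *m v k) (l *m l').
Proof.
move=> ul vl i j; rewrite mxE; apply: Un_cv_ext; first by move=> k; rewrite mxE.
apply: (@Un_cv_big _ _ _ _ _ (fun k x => u k i x * v k x j)) => [|x]; first exact: Un_cvD.
exact: Un_cvM.
Qed.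

Lemma mx_cv_const m n (l : 'M[R]_(m, n)) : mx_cv (fun=> l) l.
Proof. by move=> i j; exact: Un_cv_const. Qed.

Lemma mx_cvZ m n (a : nat -> R) (b : R) (u : nat -> 'M[R]_(m, n)) l :
  Un_cv a b -> mx_cv u l -> mx_cv (fun k => a k *: u k) (b *: l).
Proof.
move=> ab ul i j; rewrite mxE; apply: Un_cv_ext; first by move=> k; rewrite mxE.
exact: Un_cvM.
Qed.

Lemma Un_cv_tr n (u : nat -> 'M[R]_n) l : mx_cv u l ->
  Un_cv (fun k => \tr (u k)) (\tr l).
Proof. by move=> ul; apply: Un_cv_big => [|i] //; exact: Un_cvD. Qed.

Lemma Un_cv_det n (u : nat -> 'M[R]_n) l : mx_cv u l ->
  Un_cv (fun k => \det (u k)) (\det l).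
Proof.
move=> ul; apply: Un_cv_big => [|s]; first exact: Un_cvD.
apply: Un_cvM; first exact: Un_cv_const.
by apply: Un_cv_big => [|i]; [exact: Un_cvM | exact: ul].
Qed.

Lemma Un_cv_qform n (u : nat -> 'M[R]_n) l x : mx_cv u l ->
  Un_cv (fun k => qform (u k) x) (qform l x).
Proof.
move=> ul; apply: mx_cvM; last exact: mx_cv_const.
by apply: mx_cvM => //; exact: mx_cv_const.
Qed.

Lemma mx_cv_inv n (u : nat -> 'M[R]_n) l : (forall k, u k \in unitmx) ->
  l \in unitmx -> mx_cv u l -> mx_cv (fun k => invmx (u k)) (invmx l).
Proof.
move=> hu hl ul i j; rewrite /invmx hl mxE.
apply: (@Un_cv_ext (fun k => (\det (u k))^-1 * (\adj (u k)) i j)) => [k|].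
  by rewrite hu [RHS]mxE.
apply: Un_cvM; first by apply: Un_cvV (Un_cv_det ul); rewrite -unitfE -unitmxE.
rewrite mxE; apply: Un_cv_ext; first by move=> k; rewrite mxE.
apply: Un_cvM; first exact: Un_cv_const.
apply: Un_cv_det => a b; rewrite !mxE; apply: Un_cv_ext; last exact: ul.
by move=> k; rewrite !mxE.
Qed.

Section Limits.
Variables (n : nat) (X : seq 'rV[R]_n) (u : nat -> 'M[R]_n) (l : 'M[R]_n).
Hypothesis X_neq0 : forall x, x \in X -> x != 0.
Hypothesis u_pd : forall k, posdef (u k).
Hypothesis l_pd : posdef l.
Hypothesis ul : mx_cv u l.

Lemma Un_cv_qinv x : Un_cv (fun k => qinv (u k) x) (qinv l x).
Proof.
apply: (@Un_cv_qform _ (fun k => invmx (u k))); apply: mx_cv_inv => // [k|];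
  exact: posdef_unit.
Qed.

Lemma Un_cv_sum_seq (f : nat -> 'rV[R]_n -> R) g :
  (forall x, x \in X -> Un_cv (f^~ x) (g x)) ->
  Un_cv (fun k => \sum_(x <- X) f k x) (\sum_(x <- X) g x).
Proof.
move=> fg; rewrite big_seq big_mkcond.
apply: (@Un_cv_ext (fun k => \sum_(x <- X) if x \in X then f k x else 0)) => [k|].
  by rewrite -big_mkcond -big_seq.
apply: Un_cv_big => [|x]; first exact: Un_cvD.
by case: ifP => [/fg //|_]; exact: Un_cv_const.
Qed.

Lemma Un_cv_Fobj : Un_cv (fun k => Fobj X (u k)) (Fobj X l).
Proof.
apply: Un_cvD; apply: Un_cvM; try exact: Un_cv_const; last first.
  by apply: Un_cv_ln (Un_cv_det ul); exact: posdef_det_gt0.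
apply: Un_cv_sum_seq => x /X_neq0 x0.
by apply: Un_cv_ln (Un_cv_qinv x); exact: qinv_gt0.
Qed.

Lemma mx_cv_scatter : mx_cv (fun k => scatter X (u k)) (scatter X l).
Proof.
move=> i j; rewrite summxE; apply: Un_cv_ext; first by move=> k; rewrite summxE.
apply: Un_cv_sum_seq => x /X_neq0 x0; rewrite mxE.
apply: Un_cv_ext; first by move=> k; rewrite mxE.
apply: Un_cvM; last exact: Un_cv_const.
by apply: Un_cvV (Un_cv_qinv x); rewrite gt_eqF // qinv_gt0.
Qed.

Lemma mx_cv_Tmap : \tr (scatter X l) != 0 ->
  mx_cv (fun k => Tmap X (u k)) (Tmap X l).
Proof.
move=> t0; apply: mx_cvZ mx_cv_scatter.
by apply: Un_cvV => //; exact/Un_cv_tr/mx_cv_scatter.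
Qed.
End Limits.

(** * Convergence of the iteration *)

Section Iteration.
Variables (k : nat) (X : seq 'rV[R]_k.+1).
Local Notation n := k.+1.
Hypothesis X_neq0 : forall x, x \in X -> x != 0.
Hypothesis X_gt0 : (0 < size X)%N.
Hypothesis X_cond : forall L : 'M[R]_n, (1 <= \rank L <= n.-1)%N ->
  (n * count (fun x => (x <= L)%MS) X < size X * \rank L)%N.

(** The hyperplane orthogonal to a nonzero v has dimension n - 1 and cannot contain all the data. *)
Lemma X_full (v : 'rV[R]_n) : (forall x, x \in X -> (v *m x^T) 0 0 = 0) -> v = 0.
Proof.
move=> hv; apply/eqP; apply: contraT => v0.
have [|x xX] := @X_not_sub _ X X_neq0 X_gt0 X_cond (kermx v^T).
  by rewrite mxrank_ker mxrank_tr rank_rV v0 subn1.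
case/negP; apply/sub_kermxP/mx11_eq; rewrite [RHS]mxE -(hv x xX).
by rewrite -[x in LHS]trmxK -trmx_mul mxE.
Qed.

(** In the limit the forms are only known to be nonnegative; a zero at x would give x l = 0, which a
    nonsingular l excludes. *)
Lemma psd_limit_posdef (u : nat -> 'M[R]_n) l : (forall i, posdef (u i)) ->
  mx_cv u l -> \det l != 0 -> posdef l.
Proof.
move=> hu ul dl; have sl : l^T = l.
  apply/matrixP => i j; rewrite mxE; apply: Un_cv_unique (ul j i) _.
  by apply: Un_cv_ext (ul i j) => m; rewrite -[in LHS](hu m).1 mxE.
have l0 x : 0 <= qform l x.
  apply: Un_cv_le (Un_cv_const 0) (Un_cv_qform x ul) => m.
  exact: posdef_ge0.
apply: posdefI => // x x0; rewrite lt_def l0 andbT.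
apply: contra x0 => /eqP /(psd_qform_eq0 sl l0) xl; apply/eqP.
have ul' : l \in unitmx by rewrite unitmxE unitfE.
by rewrite -[x](mulmxK ul') xl mul0mx.
Qed.

Lemma Tmap_iterates S : posdef S -> \tr S = 1 ->
  let u m := iter m (Tmap X) S in
  [/\ forall m, posdef (u m), forall m, \tr (u m) = 1,
      forall m i j, `|u m i j| <= 1 &
      forall phi l, extraction phi -> mx_cv (fun m => u (phi m)) l ->
        [/\ posdef l, \tr l = 1, Tmap X l = l & Fobj X l <= Fobj X S]].
Proof.
move=> hS trS u; have hu m : posdef (u m).
  by elim: m => // m IH; exact: (Tmap_posdef X_neq0 (ltn0Sn k) X_full).
have tru m : \tr (u m) = 1.
  by case: m => // m; exact: (mxtrace_Tmap X_neq0 (ltn0Sn k) X_full).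
have desc T := @Fobj_Tmap _ X X_neq0 (ltn0Sn k) X_gt0 X_full T.
have step m : Fobj X (u m.+1) <= Fobj X (u m) by case: (desc _ (hu m) (tru m)).
have mono i j : (i <= j)%N -> Fobj X (u j) <= Fobj X (u i).
  elim: j => [|j IH]; first by rewrite leqn0 => /eqP ->.
  rewrite leq_eqVlt => /predU1P[-> //|/IH]; exact: le_trans.
split=> // [m i j | phi l hphi ul].
  apply: posdef_entry_bound => // a; rewrite -(tru m) /mxtrace (bigD1 a) //=.
  by rewrite lerDl sumr_ge0 // => b _; apply/ltW/posdef_diag_gt0.
(* Descent keeps F at most F S, so one lower bound [e] on the determinant serves all iterates and
   passes to the limit. *)
have [e e0 he] := @Fobj_coercive k X X_neq0 X_gt0 X_cond (Fobj X S).
have dl : e <= \det l.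
  apply: Un_cv_le (Un_cv_const e) (Un_cv_det ul) => m.
  by apply: he => //; exact: (mono 0%N).
have hl : posdef l.
  by apply: psd_limit_posdef ul _ => //; rewrite gt_eqF // (lt_le_trans e0).
have trl : \tr l = 1.
  apply: Un_cv_unique (Un_cv_tr ul) _; apply: Un_cv_ext (Un_cv_const 1) => m.
  by rewrite tru.
have Fl := Un_cv_Fobj X_neq0 (fun m => hu (phi m)) hl ul.
have hT : posdef (Tmap X l) by exact: (Tmap_posdef X_neq0 (ltn0Sn k) X_full).
have tl : \tr (scatter X l) != 0.
  by rewrite gt_eqF // mxtrace_posdef_gt0 //; exact: (scatter_posdef X_neq0 X_full).
have ul1 := mx_cv_Tmap X_neq0 (fun m => hu (phi m)) hl ul tl.
have FTl := Un_cv_Fobj X_neq0 (fun m => hu (phi m).+1) hT ul1.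
have [le eq] := desc l hl trl.
(* Since phi m + 1 <= phi (m + 1), F at iterate phi (m + 1) is at most F at the image under T of
   iterate phi m. In the limit T does not lower F at [l]. *)
have ge : Fobj X l <= Fobj X (Tmap X l).
  have hS1 : extraction succn by move=> m; exact: ltnSn.
  by apply: Un_cv_le (Un_cv_extract hS1 Fl) FTl => m; exact: mono (hphi m).
split=> //; first by apply: eq; apply/le_anti; rewrite le.
by apply: Un_cv_le Fl (Un_cv_const _) => m; exact: (mono 0%N).
Qed.

Lemma Tmap_cv_minimizer S0 : posdef S0 ->
  exists Sstar, is_trace1_minimizer X Sstar /\
    (forall S, is_trace1_minimizer X S -> S = Sstar) /\
    mx_cv (fun m => iter m (Tmap X) S0) Sstar.
Proof.
move=> h0; have n0 := ltn0Sn k.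
(* The starting matrix may have any trace, so the argument is run from its first image under T. *)
have h1 := Tmap_posdef X_neq0 n0 X_full h0.
have tr1 := mxtrace_Tmap X_neq0 n0 X_full h0.
have cluster S : posdef S -> \tr S = 1 -> exists l,
    [/\ posdef l, \tr l = 1, Tmap X l = l & Fobj X l <= Fobj X S].
  move=> hS trS; have [_ _ bnd cl] := Tmap_iterates hS trS.
  have [phi hphi [l hl]] := mx_compact bnd.
  by exists l; exact: cl hphi hl.
have [L [hL trL TL _]] := cluster _ h1 tr1.
have uniqL S : posdef S -> \tr S = 1 -> Tmap X S = S -> S = L.
  by move=> hS trS TS; exact: (Tmap_fixed_unique X_neq0 n0 X_gt0 X_cond).
(* The iteration started at the competitor S has a cluster point with value at most F S; it is a
   fixed point, hence equal to [L]. *)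
have minL S : posdef S -> \tr S = 1 -> Fobj X L <= Fobj X S.
  move=> hS trS; have [l [hl trl Tl lS]] := cluster _ hS trS.
  by rewrite -(uniqL l).
exists L; split; first by split=> //; split=> // S hS trS; exact/RleP/minL.
split=> [S [hS [trS minS]]|].
  (* T cannot improve a minimizer, so the equality case of descent makes it a fixed point. *)
  apply: uniqL => //; have [le eq] := Fobj_Tmap X_neq0 n0 X_gt0 X_full hS trS.
  apply/eq/le_anti; rewrite le /=; apply/RleP/minS.
    exact: (Tmap_posdef X_neq0 n0 X_full hS).
  exact: (mxtrace_Tmap X_neq0 n0 X_full hS).
have [_ _ bnd cl] := Tmap_iterates h1 tr1.
have cv1 : mx_cv (fun m => iter m (Tmap X) (Tmap X S0)) L.
  apply: mx_cv_clusters bnd _ => phi l hphi hl.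
  by have [] := cl phi l hphi hl => *; exact: uniqL.
move=> i j; apply/Un_cvP => e e0; have /Un_cvP/(_ e e0)[N hN] := cv1 i j.
by exists N.+1 => -[//|m] Nm; rewrite iterSr; exact: hN.
Qed.
End Iteration.

Theorem theorem3 (D : nat) (X : seq 'rV[R]_D) (Sigma0 : 'M[R]_D) :
  (0 < D)%N ->
  (0 < size X)%N ->
  uniq X ->
  (forall x, x \in X -> x != 0%R) ->
  (forall L : 'M[R]_D,
     (1 <= \rank L <= D.-1)%N ->
     Rlt (Rdiv (INR (count (fun x => (x <= L)%MS) X)) (INR (size X)))
         (Rdiv (INR (\rank L)) (INR D))) ->
  posdef Sigma0 ->
  exists Sstar : 'M[R]_D,
    is_trace1_minimizer X Sstar /\
    (forall S, is_trace1_minimizer X S -> S = Sstar) /\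
    mx_cv (fun k => iter k (Tmap X) Sigma0) Sstar.
Proof.
case: D X Sigma0 => // k X S0 _ X0 _ Xn0 cond; apply: Tmap_cv_minimizer => //.
move=> L /cond /RltP; rewrite !INR_natr => h.
have {}h : (count (fun x => (x <= L)%MS) X)%:R / (size X)%:R <
   (\rank L)%:R / k.+1%:R :> R by exact: h.
move: h; rewrite ltr_pdivrMr ?ltr0n // mulrAC ltr_pdivlMr ?ltr0n //.
by rewrite -!natrM ltr_nat mulnC [(size X * _)%N]mulnC.
Qed.
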